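(* Consider the fully explicit scheme described in the context. It satisfies the following. (i) It is a conservative scheme for the water height $h$, i.e. for all $j$, $$h_j^{n+1}=h_j^n-\frac{\Delta t}{\Delta x_j}\left(u^*_{j+1/2}h^{n+1-}_{j+1/2}-u^*_{j-1/2}h^{n+1-}_{j-1/2}\right).$$ It is also a conservative scheme for $hu$ when the topography source term vanishes: in that case, for all $j$, $$(hu)_j^{n+1}=(hu)_j^n-\frac{\Delta t}{\Delta x_j}\left(u^*_{j+1/2}(hu)^{n+1-}_{j+1/2}+\Pi^*_{j+1/2}-u^*_{j-1/2}(hu)^{n+1-}_{j-1/2}-\Pi^*_{j-1/2}\right).$$ Moreover, assume that at every time step the Whitham subcharacteristic condition (see context) and the CFL conditions $$\max_j\frac{\Delta t}{h_j^n\Delta x_j}\le\frac1{2a}\quad\text{and}\quad \max_j\frac{\Delta t}{\Delta x_j}\left((u^*_{j-1/2})^+-(u^*_{j+1/2})^-\right)<1$$ hold. Then: (ii) the water height $h_j^n$ is positive for all $j$ and $n>0$ provided that $h_j^0$ is positive for all $j$; (iii) the scheme is well-balanced with respect to the lake at rest: if $u_j^n=0$ and $h_j^n+z_j=h_{j+1}^n+z_{j+1}$ for all $j\in\mathbb Z$, then $h_j^{n+1}=h_j^n$ and $u_j^{n+1}=0$ for all $j\in\mathbb Z$; (iv) when the bottom is flat ($z_j$ independent of $j$), the scheme degenerates to the classic Lagrange-Projection scheme (see context).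
   Context: The shallow water equations are $\partial_t h+\partial_x(hu)=0$, $\partial_t(hu)+\partial_x(hu^2+gh^2/2)=-gh\,\partial_xz$, $g>0$. Cells are indexed by $j\in\mathbb Z$ with sizes $\Delta x_j>0$; $\Delta t>0$ is the time step; $z_j$ is the discrete topography in cell $j$; $a>0$ is a constant. Notation: $v^+=\max(v,0)$, $v^-=\min(v,0)$. Given $(h_j^n,(hu)_j^n)_j$ with $h^n_j>0$, set $u_j^n=(hu)_j^n/h_j^n$, $\tau_j^n=1/h_j^n$, $\Pi_j^n=g(h_j^n)^2/2$, $\Delta m_j=\Delta x_jh_j^n$, $\Delta m_{j+1/2}=(\Delta m_j+\Delta m_{j+1})/2$, and $$S_{j+1/2}^n=\frac g2\left(h_j^n+h_{j+1}^n\right)\frac{z_{j+1}-z_j}{\Delta m_{j+1/2}},\qquad S_j^n=\frac12\left(\frac{\Delta m_{j+1/2}}{\Delta m_j}S_{j+1/2}^n+\frac{\Delta m_{j-1/2}}{\Delta m_j}S_{j-1/2}^n\right),$$ (these are the discretizations of the topography source term $\frac g\tau\partial_mz$), and $$u^*_{j+1/2}=\frac{u_j^n+u_{j+1}^n}2-\frac{\Pi_{j+1}^n-\Pi_j^n}{2a}-\frac{\Delta m_{j+1/2}}{2a}S_{j+1/2}^n,\qquad \Pi^*_{j+1/2}=\frac{\Pi_j^n+\Pi_{j+1}^n}2-\frac a2(u_{j+1}^n-u_j^n).$$ Acoustic (Lagrangian) step: $$\tau_j^{n+1-}=\tau_j^n+\frac{\Delta t}{\Delta m_j}(u^*_{j+1/2}-u^*_{j-1/2}),\qquad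 u_j^{n+1-}=u_j^n-\frac{\Delta t}{\Delta m_j}(\Pi^*_{j+1/2}-\Pi^*_{j-1/2})-\Delta t\,S_j^n,$$ $$\Pi_j^{n+1-}=\Pi_j^n-\frac{\Delta t}{\Delta m_j}a^2(u^*_{j+1/2}-u^*_{j-1/2}).$$ Equivalently, with $L_j=1+\frac{\Delta t}{\Delta x_j}(u^*_{j+1/2}-u^*_{j-1/2})$: $L_jh_j^{n+1-}=h_j^n$ and $L_j(hu)_j^{n+1-}=(hu)_j^n-\frac{\Delta t}{\Delta x_j}(\Pi^*_{j+1/2}-\Pi^*_{j-1/2})-\Delta t\,h_j^nS_j^n$. Transport (projection) step, for $\varphi\in\{h,hu\}$: $$\varphi_j^{n+1}=\varphi_j^{n+1-}-\frac{\Delta t}{\Delta x_j}\left(u^*_{j+1/2}\varphi^{n+1-}_{j+1/2}-u^*_{j-1/2}\varphi^{n+1-}_{j-1/2}\right)+\frac{\Delta t}{\Delta x_j}\varphi_j^{n+1-}(u^*_{j+1/2}-u^*_{j-1/2}),$$ with $\varphi^{n+1-}_{j+1/2}=\varphi_j^{n+1-}$ if $u^*_{j+1/2}\ge0$ and $\varphi^{n+1-}_{j+1/2}=\varphi_{j+1}^{n+1-}$ if $u^*_{j+1/2}<0$. Whitham subcharacteristic condition: $a>\sqrt{g\tau^{-3}}$ (that is $a>c(\tau)/\tau$ with $c^2=g/\tau$) for all values $\tau>0$ spanned by the specific volume during the time step, i.e. all $\tau$ between $\tau_j^n$ and $\tau_j^{n+1-}$, for all $j$. Classic Lagrange-Projection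 scheme: the two-step scheme for the barotropic Euler system $\partial_th+\partial_x(hu)=0$, $\partial_t(hu)+\partial_x(hu^2+p)=0$, $p=gh^2/2$, consisting of the acoustic step $L_jh_j^{n+1-}=h_j^n$, $L_j(hu)_j^{n+1-}=(hu)_j^n-\frac{\Delta t}{\Delta x_j}(\Pi^*_{j+1/2}-\Pi^*_{j-1/2})$ with $L_j=1+\frac{\Delta t}{\Delta x_j}(u^*_{j+1/2}-u^*_{j-1/2})$ and fluxes $u^*_{j+1/2}=\frac{u_j^n+u_{j+1}^n}2-\frac{\Pi_{j+1}^n-\Pi_j^n}{2a}$, $\Pi^*_{j+1/2}=\frac{\Pi_j^n+\Pi_{j+1}^n}2-\frac a2(u_{j+1}^n-u_j^n)$, followed by the same upwind transport step. *)

(* Defs.v *)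
From HB Require Import structures.
From mathcomp Require Import all_boot all_order all_algebra.

Set Implicit Arguments.
Unset Strict Implicit.
Unset Printing Implicit Defensive.

Import Order.TTheory GRing.Theory Num.Theory.
Local Open Scope ring_scope.

(* Indexing convention: cells are indexed by j : int, and an interface quantity
   evaluated at j stands for its value at j + 1/2; hence the value at j - 1/2
   is obtained at index j - 1. *)

Record params (R : rcfType) := Params {
  grav : R;          (* g *)
  imp : R;           (* the relaxation constant a *)
  dt : R;
  dx : int -> R
}.

Record state (R : rcfType) := State {
  height : int -> R;    (* h *)
  disch : int -> R      (* hu *)
}.

Section CellQuantities.
Context {R : rcfType}.
Implicit Types (D : params R) (U : state R) (j : int).

Definition velocity U j : R := disch U j / height U j.
Definition spec_vol U j : R := 1 / height U j.
Definition pressure D U j : R := grav D * height U j ^+ 2 / 2.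

Definition dm D U j : R := dx D j * height U j.
Definition dm_half D U j : R := (dm D U j + dm D U (j + 1)) / 2.

Definition Pistar D U j : R :=
  (pressure D U j + pressure D U (j + 1)) / 2
  - imp D / 2 * (velocity U (j + 1) - velocity U j).

End CellQuantities.

Section Transport.
Context {R : rcfType}.
Implicit Types (D : params R) (w phi : int -> R) (j : int).

Definition upwind w phi j : R := if 0 <= w j then phi j else phi (j + 1).

Definition transport D w phi j : R :=
  phi j
  - dt D / dx D j * (w j * upwind w phi j - w (j - 1) * upwind w phi (j - 1))
  + dt D / dx D j * phi j * (w j - w (j - 1)).

End Transport.

Section Scheme.
Context {R : rcfType}.
Implicit Types (D : params R) (z : int -> R) (U : state R) (j : int).

Definition source_half D z U j : R :=
  grav D / 2 * (height U j + height U (j + 1))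
  * ((z (j + 1) - z j) / dm_half D U j).

Definition source D z U j : R :=
  (dm_half D U j / dm D U j * source_half D z U j
   + dm_half D U (j - 1) / dm D U j * source_half D z U (j - 1)) / 2.

Definition ustar D z U j : R :=
  (velocity U j + velocity U (j + 1)) / 2
  - (pressure D U (j + 1) - pressure D U j) / (2 * imp D)
  - dm_half D U j / (2 * imp D) * source_half D z U j.

Definition spec_vol_lag D z U j : R :=
  spec_vol U j + dt D / dm D U j * (ustar D z U j - ustar D z U (j - 1)).

Definition velocity_lag D z U j : R :=
  velocity U j - dt D / dm D U j * (Pistar D U j - Pistar D U (j - 1))
  - dt D * source D z U j.

(* This value is discarded by the transport step: at the beginning of the next
   time step the pressure is set again to its equilibrium value g h^2 / 2. *)
Definition pressure_lag D z U j : R :=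
  pressure D U j
  - dt D / dm D U j * imp D ^+ 2 * (ustar D z U j - ustar D z U (j - 1)).

Definition acoustic D z U : state R :=
  State (fun j => 1 / spec_vol_lag D z U j)
        (fun j => 1 / spec_vol_lag D z U j * velocity_lag D z U j).

Definition step D z U : state R :=
  let V := acoustic D z U in
  State (transport D (ustar D z U) (height V))
        (transport D (ustar D z U) (disch V)).

Definition whitham D z U : Prop :=
  forall (j : int) (tau : R), 0 < tau ->
    Num.min (spec_vol U j) (spec_vol_lag D z U j) <= tau ->
    tau <= Num.max (spec_vol U j) (spec_vol_lag D z U j) ->
    Num.sqrt (grav D * tau ^- 3) < imp D.

(* Bounds on a maximum over all cells are required cell by cell. *)
Definition cfl D z U : Prop :=
  (forall j, dt D / (height U j * dx D j) <= 1 / (2 * imp D)) /\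
  (forall j, dt D / dx D j * (Num.max (ustar D z U (j - 1)) 0
                              - Num.min (ustar D z U j) 0) < 1).

End Scheme.

Section ClassicLagrangeProjection.
Context {R : rcfType}.
Implicit Types (D : params R) (U : state R) (j : int).

Definition lp_ustar D U j : R :=
  (velocity U j + velocity U (j + 1)) / 2
  - (pressure D U (j + 1) - pressure D U j) / (2 * imp D).

Definition lp_L D U j : R :=
  1 + dt D / dx D j * (lp_ustar D U j - lp_ustar D U (j - 1)).

(* The acoustic relations L_j h_j = .. and L_j (hu)_j = .., solved for the new
   state; L_j is positive under the second CFL condition. *)
Definition lp_acoustic D U : state R :=
  State (fun j => height U j / lp_L D U j)
        (fun j => (disch U j
                   - dt D / dx D j * (Pistar D U j - Pistar D U (j - 1)))
                  / lp_L D U j).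

Definition lp_step D U : state R :=
  let V := lp_acoustic D U in
  State (transport D (lp_ustar D U) (height V))
        (transport D (lp_ustar D U) (disch V)).

End ClassicLagrangeProjection.

(* Main.v *)
(** With [L j = dilation D z U j = 1 + dt / dx j * (ustar j - ustar (j - 1))], the
    acoustic step multiplies the specific volume by [L], so [L j] times the Lagrangian value
    is the old value up to the pressure fluxes and the source; the transport
    step subtracts the upwind flux difference from [L j] times the Lagrangian
    value, which gives conservation.  The second CFL condition makes [L] positive and
    turns the transport step into a convex combination of three neighbouring
    values, hence positivity.  For the lake at rest,
    [dm_half j * source_half j] is exactly the opposite of the pressure jump:
    the interface velocities vanish and the source balances the pressure
    fluxes. *)

Require Import Defs.
From HB Require Import structures.
From mathcomp Require Import all_boot all_order all_algebra.
From mathcomp Require Import ring lra.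

Set Implicit Arguments.
Unset Strict Implicit.
Unset Printing Implicit Defensive.

Import Order.TTheory GRing.Theory Num.Theory.
Local Open Scope ring_scope.

(** * The upwind transport step *)

Section Transport.
Context {R : rcfType}.
Implicit Types (D : params R) (w phi : int -> R) (j : int).

Lemma transportE D w phi j :
  transport D w phi j =
    phi j * (1 + dt D / dx D j * (w j - w (j - 1)))
    - dt D / dx D j * (w j * upwind w phi j - w (j - 1) * upwind w phi (j - 1)).
Proof. rewrite /transport; ring. Qed.

Lemma eq_transport D w1 w2 phi1 phi2 j :
  w1 =1 w2 -> phi1 =1 phi2 -> transport D w1 phi1 j = transport D w2 phi2 j.
Proof. by move=> ew ephi; rewrite /transport /upwind !ew !ephi. Qed.

Lemma transport0 D w phi j : w =1 (fun=> 0) -> transport D w phi j = phi j.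
Proof. by move=> w0; rewrite /transport !w0; ring. Qed.

Lemma mul_upwind w phi j :
  w j * upwind w phi j =
    Num.max (w j) 0 * phi j + Num.min (w j) 0 * phi (j + 1).
Proof. by rewrite /upwind; case: leP => _; ring. Qed.

(** The term [phi j * (w j - w (j - 1))] cancels the outgoing parts of the upwind fluxes, so only
    inflow velocities remain; the three weights sum to one. *)
Lemma transport_convex D w phi j :
  transport D w phi j =
    (1 - dt D / dx D j * (Num.max (w (j - 1)) 0 - Num.min (w j) 0)) * phi j
    + dt D / dx D j * Num.max (w (j - 1)) 0 * phi (j - 1)
    + dt D / dx D j * - Num.min (w j) 0 * phi (j + 1).
Proof.
rewrite /transport !mul_upwind subrK.
have wE k : w k = Num.max (w k) 0 + Num.min (w k) 0.
  by rewrite addr_max_min addr0.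
move: (wE j) (wE (j - 1)).
(* Positive and negative parts become independent variables, so that replacing [w] by their sum does
   not rewrite inside them. *)
move: (Num.max _ _) (Num.min _ _) (Num.max _ _) (Num.min _ _).
by move=> ? ? ? ? -> ->; ring.
Qed.

(** The strict CFL bound makes the weight of [phi j] positive; the neighbours only need nonnegative
    weights. *)
Lemma transport_gt0 D w phi j :
    0 <= dt D / dx D j ->
    dt D / dx D j * (Num.max (w (j - 1)) 0 - Num.min (w j) 0) < 1 ->
    (forall k, 0 < phi k) ->
  0 < transport D w phi j.
Proof.
move=> r_ge0 cflj phi_gt0; rewrite transport_convex.
rewrite -addrA ltr_wpDr ?mulr_gt0 ?subr_gt0 //.
have max_ge0 : 0 <= Num.max (w (j - 1)) 0 by rewrite le_max lexx orbT.
have min_le0 : Num.min (w j) 0 <= 0 by rewrite ge_min lexx orbT.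
have phi_ge0 k := ltW (phi_gt0 k).
by rewrite addr_ge0 ?(mulr_ge0 (mulr_ge0 _ _)) // oppr_ge0.
Qed.

End Transport.

(** * The acoustic step and its dilation factor *)

Section Acoustic.
Context {R : rcfType}.
Implicit Types (D : params R) (z : int -> R) (U : state R) (j : int).

Definition dilation D z U j : R :=
  1 + dt D / dx D j * (ustar D z U j - ustar D z U (j - 1)).

(** The CFL quantity dominates the compression of the cell, since a velocity lies below its positive
    part and above its negative part. *)
Lemma dilation_gt0 D z U j :
    0 < dt D / dx D j ->
    dt D / dx D j
      * (Num.max (ustar D z U (j - 1)) 0 - Num.min (ustar D z U j) 0) < 1 ->
  0 < dilation D z U j.
Proof.
move=> r_gt0 cflj; rewrite /dilation.
rewrite -ltrBlDl sub0r ltrNl -mulrN; apply: le_lt_trans cflj.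
by rewrite ler_pM2l // opprB lerB // ?le_max ?ge_min lexx.
Qed.

Lemma spec_vol_lagE D z U j :
  height U j != 0 -> dx D j != 0 ->
  spec_vol_lag D z U j = dilation D z U j / height U j.
Proof.
by move=> h0 dx0; rewrite /spec_vol_lag /spec_vol /dilation /dm; field; apply/andP.
Qed.

Lemma height_acousticE D z U j :
  height U j != 0 -> dx D j != 0 ->
  height (acoustic D z U) j = height U j / dilation D z U j.
Proof. by move=> h0 dx0; rewrite /= spec_vol_lagE // div1r invf_div. Qed.

Lemma disch_acousticE D z U j :
  height U j != 0 -> dx D j != 0 -> source D z U j = 0 ->
  disch (acoustic D z U) j =
    (disch U j - dt D / dx D j * (Pistar D U j - Pistar D U (j - 1)))
    / dilation D z U j.
Proof.
move=> h0 dx0 s0; rewrite /= spec_vol_lagE // div1r invf_div.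
rewrite mulrAC; congr (_ / _).
by rewrite /velocity_lag s0 /velocity /dm; field; apply/andP.
Qed.

Lemma source_half_flat D z U j :
  z (j + 1) = z j -> source_half D z U j = 0.
Proof. by move=> ez; rewrite /source_half ez subrr mul0r mulr0. Qed.

Lemma source_flat D z U j : (forall k, z (k + 1) = z k) -> source D z U j = 0.
Proof.
by move=> ez; rewrite /source !source_half_flat // !mulr0 addr0 mul0r.
Qed.

Lemma ustar_flat D z U j : z (j + 1) = z j -> ustar D z U j = lp_ustar D U j.
Proof. by move=> ez; rewrite /ustar source_half_flat // mulr0 subr0. Qed.

End Acoustic.

(** * Lake at rest *)

Section LakeAtRest.
Context {R : rcfType}.
Variables (D : params R) (z : int -> R) (U : state R).
Hypothesis dx_gt0 : forall j, 0 < dx D j.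
Hypothesis height_gt0 : forall j, 0 < height U j.
Hypothesis velocity0 : forall j, velocity U j = 0.
Hypothesis surface_flat :
  forall j, height U j + z j = height U (j + 1) + z (j + 1).

(** A flat surface turns the jump of [z] into the opposite jump of the height; multiplied by the sum
    of the two heights it is a difference of squares. *)
Lemma dm_half_source_half_rest j :
  dm_half D U j * source_half D z U j = - (pressure D U (j + 1) - pressure D U j).
Proof.
have dm_gt0 k : 0 < dm D U k by rewrite mulr_gt0.
have dmh_neq0 : dm_half D U j != 0.
  by rewrite gt_eqF // divr_gt0 // addr_gt0.
have -> : source_half D z U j =
    grav D / 2 * (height U j + height U (j + 1))
      * (height U j - height U (j + 1)) / dm_half D U j.
  have -> : height U j - height U (j + 1) = z (j + 1) - z j.
    by have := surface_flat j; lra.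
  by rewrite /source_half mulrA.
by rewrite mulrC divfK // /pressure; field.
Qed.

Lemma ustar_rest j : ustar D z U j = 0.
Proof.
rewrite /ustar !velocity0 [_ / _ * source_half _ _ _ _]mulrAC.
by rewrite dm_half_source_half_rest; ring.
Qed.

(** At rest [Pistar] is the mean of the two adjacent pressures, so its difference across a cell is
    the mean of the two interface pressure jumps. *)
Lemma source_rest j :
  dm D U j * source D z U j = - (Pistar D U j - Pistar D U (j - 1)).
Proof.
have dm_neq0 : dm D U j != 0 by rewrite gt_eqF // mulr_gt0.
have -> : source D z U j =
    (dm_half D U j * source_half D z U j
     + dm_half D U (j - 1) * source_half D z U (j - 1)) / 2 / dm D U j.
  by rewrite /source; field.
rewrite mulrC divfK // !dm_half_source_half_rest /Pistar !velocity0 subrK.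
by field.
Qed.

Lemma velocity_lag_rest j : velocity_lag D z U j = 0.
Proof.
have dm_neq0 : dm D U j != 0 by rewrite gt_eqF // mulr_gt0.
rewrite /velocity_lag velocity0 -[Pistar _ _ _ - _]opprK -source_rest.
by field.
Qed.

Lemma height_step_rest j : height (step D z U) j = height U j.
Proof.
rewrite /= transport0; last exact: ustar_rest.
by rewrite /spec_vol_lag !ustar_rest subrr mulr0 addr0 /spec_vol !div1r invrK.
Qed.

Lemma velocity_step_rest j : velocity (step D z U) j = 0.
Proof.
rewrite /velocity /= transport0; last exact: ustar_rest.
by rewrite velocity_lag_rest mulr0 mul0r.
Qed.

End LakeAtRest.

(** * Conservation and positivity for one full step *)

Section Conservation.
Context {R : rcfType}.
Variables (D : params R) (z : int -> R) (U : state R).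
Hypothesis dx_gt0 : forall j, 0 < dx D j.
Hypothesis height_gt0 : forall j, 0 < height U j.

Let dx_neq0 j : dx D j != 0. Proof. by rewrite gt_eqF. Qed.
Let height_neq0 j : height U j != 0. Proof. by rewrite gt_eqF. Qed.

Lemma height_step_conservative j :
  spec_vol_lag D z U j != 0 ->
  let us := ustar D z U in
  let h := height (acoustic D z U) in
  height (step D z U) j =
    height U j
    - dt D / dx D j * (us j * upwind us h j - us (j - 1) * upwind us h (j - 1)).
Proof.
move=> tau_neq0 us h; have L_neq0 : dilation D z U j != 0.
  by move: tau_neq0; rewrite spec_vol_lagE // mulf_eq0 negb_or => /andP[].
rewrite [LHS]transportE -/(dilation D z U j) -/us -/h; congr (_ - _).
by rewrite [h j]height_acousticE // divfK.
Qed.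

(** Multiplying by the dilation factor undoes the acoustic division, so the pressure fluxes join the
    upwind fluxes in a single difference. *)
Lemma disch_step_conservative j :
  spec_vol_lag D z U j != 0 -> source D z U j = 0 ->
  let us := ustar D z U in
  let q := disch (acoustic D z U) in
  disch (step D z U) j =
    disch U j
    - dt D / dx D j
      * (us j * upwind us q j + Pistar D U j
         - us (j - 1) * upwind us q (j - 1) - Pistar D U (j - 1)).
Proof.
move=> tau_neq0 s0 us q; have L_neq0 : dilation D z U j != 0.
  by move: tau_neq0; rewrite spec_vol_lagE // mulf_eq0 negb_or => /andP[].
rewrite [LHS]transportE -/(dilation D z U j) -/us -/q.
by rewrite [q j]disch_acousticE // divfK //; ring.
Qed.

Lemma height_step_gt0 j :
  0 < dt D -> cfl D z U -> 0 < height (step D z U) j.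
Proof.
move=> dt_gt0 [_ cfl2]; have r_gt0 k : 0 < dt D / dx D k by rewrite divr_gt0.
apply: (transport_gt0 (phi := height (acoustic D z U))) => [||k]; rewrite ?(ltW (r_gt0 _)) //.
by rewrite height_acousticE // divr_gt0 // dilation_gt0.
Qed.

(** * Flat bottom and the classic scheme *)

Section FlatBottom.
Hypothesis z_flat : forall k, z (k + 1) = z k.

Lemma dilation_flat j : dilation D z U j = lp_L D U j.
Proof. by rewrite /dilation !ustar_flat. Qed.

Lemma height_acoustic_flat j :
  height (acoustic D z U) j = height (lp_acoustic D U) j.
Proof. by rewrite height_acousticE // dilation_flat. Qed.

Lemma disch_acoustic_flat j :
  disch (acoustic D z U) j = disch (lp_acoustic D U) j.
Proof. by rewrite disch_acousticE ?source_flat // dilation_flat. Qed.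

Lemma height_step_flat j : height (step D z U) j = height (lp_step D U) j.
Proof.
apply: eq_transport => k; first exact: ustar_flat.
exact: height_acoustic_flat.
Qed.

Lemma disch_step_flat j : disch (step D z U) j = disch (lp_step D U) j.
Proof.
apply: eq_transport => k; first exact: ustar_flat.
exact: disch_acoustic_flat.
Qed.

End FlatBottom.

End Conservation.

Theorem proposition2 (R : rcfType) (D : params R) (z : int -> R)
    (U : nat -> state R)
    (grav_gt0 : 0 < grav D) (imp_gt0 : 0 < imp D)
    (dt_gt0 : 0 < dt D) (dx_gt0 : forall j : int, 0 < dx D j)
    (U_scheme : forall n : nat, U n.+1 = step D z (U n)) :
  (* (i): the hypothesis spec_vol_lag != 0 says that the acoustic step is well
     defined, i.e. that its water height 1 / spec_vol_lag exists *)
  (forall n : nat,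
     (forall j : int, 0 < height (U n) j) ->
     (forall j : int, spec_vol_lag D z (U n) j != 0) ->
     let us := ustar D z (U n) in
     let V := acoustic D z (U n) in
     (forall j : int,
        height (U n.+1) j =
          height (U n) j
          - dt D / dx D j * (us j * upwind us (height V) j
                             - us (j - 1) * upwind us (height V) (j - 1)))
     /\
     ((forall j : int, source D z (U n) j = 0) ->
      forall j : int,
        disch (U n.+1) j =
          disch (U n) j
          - dt D / dx D j
            * (us j * upwind us (disch V) j + Pistar D (U n) j
               - us (j - 1) * upwind us (disch V) (j - 1)
               - Pistar D (U n) (j - 1))))
  /\
  ((forall n : nat, whitham D z (U n) /\ cfl D z (U n)) ->
   [/\ (* (ii) *)
       (forall j : int, 0 < height (U 0%N) j) ->
       forall (n : nat) (j : int), (0 < n)%N -> 0 < height (U n) j,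
       (* (iii) *)
       forall n : nat,
         (forall j : int, 0 < height (U n) j) ->
         (forall j : int, velocity (U n) j = 0) ->
         (forall j : int,
            height (U n) j + z j = height (U n) (j + 1) + z (j + 1)) ->
         forall j : int,
           height (U n.+1) j = height (U n) j /\ velocity (U n.+1) j = 0
     & (* (iv) *)
       (forall j k : int, z j = z k) ->
       forall n : nat,
         (forall j : int, 0 < height (U n) j) ->
         forall j : int,
           [/\ ustar D z (U n) j = lp_ustar D (U n) j,
               height (acoustic D z (U n)) j = height (lp_acoustic D (U n)) j,
               disch (acoustic D z (U n)) j = disch (lp_acoustic D (U n)) j,
               height (U n.+1) j = height (lp_step D (U n)) j
             & disch (U n.+1) j = disch (lp_step D (U n)) j]]).
Proof.
split=> [n h_gt0 tau_neq0 us V|whitham_cfl].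
  by split=> [|s0] j; rewrite U_scheme;
    [exact: height_step_conservative|exact: disch_step_conservative].
split=> [h0_gt0 n j _|n h_gt0 u0 flat j|z_const n h_gt0 j].
(* The cell [j] stays general in the induction because the new height depends on neighbouring
   cells. *)
- elim: n j => [//|n IHn] j; rewrite U_scheme.
  by apply: height_step_gt0 => //; case: (whitham_cfl n).
- by rewrite U_scheme height_step_rest // velocity_step_rest.
- have z_flat k : z (k + 1) = z k by exact: z_const.
  rewrite U_scheme; split.
  + exact: ustar_flat.
  + exact: height_acoustic_flat.
  + exact: disch_acoustic_flat.
  + exact: height_step_flat.
  + exact: disch_step_flat.
Qed.
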